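(* Let $E \subseteq \mathbb{R}$. If $\dim_{\mathrm{CM}}(E) > 0$, then there exist $n \in \mathbb{N}$ and a linear map $T : \mathbb{R}^n \to \mathbb{R}$ such that $T(E^n)$ is dense in $\mathbb{R}$. In particular, if there is a real $s > 0$ such that $\mathscr{N}((-r,r) \cap E) \geq r^s$ for all sufficiently large $r \in \mathbb{R}$, then there exist $n \in \mathbb{N}$ and a linear $T : \mathbb{R}^n \to \mathbb{R}$ such that $T(E^n)$ is dense.
   Context: For a bounded $X \subseteq \mathbb{R}^n$, $\mathscr{M}(1,X)$ denotes the minimum number of open balls of radius $1$ needed to cover $X$. Let $B_n(r)$ be the open ball in $\mathbb{R}^n$ of radius $r$ centered at $0$. The coarse Minkowski dimension of $Z \subseteq \mathbb{R}^n$ is $\dim_{\mathrm{CM}}(Z) := \limsup_{r \to \infty} \frac{\log \mathscr{M}(1, B_n(r) \cap Z)}{\log r}$. For bounded $X \subseteq \mathbb{R}$, $\mathscr{N}(X)$ is the number of integers $k$ such that $[k,k+1] \cap X \neq \emptyset$. $E^n$ denotes the $n$-fold Cartesian power of $E$. *)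

(* Defs.v *)
From HB Require Import structures.
From mathcomp Require Import all_boot all_order all_algebra.
From mathcomp Require Import all_classical all_reals all_analysis.
From mathcomp Require Import Rstruct Rstruct_topology.
Set Implicit Arguments. Unset Strict Implicit. Unset Printing Implicit Defensive.
Import Order.TTheory GRing.Theory Num.Theory.
Import numFieldNormedType.Exports.
Local Open Scope classical_set_scope.
Local Open Scope ring_scope.

Notation RR := Rdefinitions.R.

Definition B1 (r : RR) : set RR := [set x | `|x| < r].

Definition cover_sizes (X : set RR) : set nat :=
  [set m | exists c : 'I_m -> RR, X `<=` [set x | exists i, `|x - c i| < 1]].
Definition covnum (X : set RR) : RR := inf [set m%:R | m in cover_sizes X].

Definition limsup_pinfty (f : RR -> RR) : \bar RR :=
  ereal_inf [set ereal_sup [set (f r)%:E | r in [set r | R0 < r]] | R0 in [set: RR]].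

Definition dimCM (Z : set RR) : \bar RR :=
  limsup_pinfty (fun r => ln (covnum (B1 r `&` Z)) / ln r).

(* N(X): the number of integers k with [k, k+1] ∩ X nonempty
   (the supremum of the sizes of duplicate-free lists of such integers). *)
Definition meets_int (X : set RR) (k : int) : Prop :=
  exists x, X x /\ k%:~R <= x <= k%:~R + 1.
Definition Nint (X : set RR) : RR :=
  sup [set (size s)%:R | s in [set s : seq int | uniq s /\ forall k, k \in s -> meets_int X k]].

Definition cartpow (E : set RR) (n : nat) : set 'rV[RR]_n :=
  [set x | forall i : 'I_n, E (x ord0 i)].
Arguments cartpow E n : clear implicits.

(* Main.v *)
(* Fix n with n s >= 2, where s > 0 is a growth exponent of E.  For arbitrarily
   large r, the set E^n contains about r^(n s) >= r^2 coarsely separated points of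
   norm O(r), while a linear form a maps them into an interval of length O(r).
   By pigeonhole there are x, y in E^n with |a (x - y)| <= 1 and some
   |x_i - y_i| as large as we please; so any value q is taken at x - y by a form
   arbitrarily close to a, obtained by changing only the coefficient a_i.  Hence
   for each ball B the forms taking a value in B on E^n - E^n are open and dense,
   and by Baire some form has dense image on E^n - E^n, that is, gives a linear
   map on R^(2n) with dense image of E^(2n). *)
Require Import Defs.
From HB Require Import structures.
From mathcomp Require Import all_boot all_order all_algebra.
From mathcomp Require Import all_classical all_reals all_analysis.
From mathcomp Require Import Rstruct Rstruct_topology.
From mathcomp Require Import zify ring lra.
Set Implicit Arguments. Unset Strict Implicit. Unset Printing Implicit Defensive.
Import Order.TTheory GRing.Theory Num.Theory.
Import numFieldNormedType.Exports.
Local Open Scope classical_set_scope.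
Local Open Scope ring_scope.

(** * Unit cells and the two counting functions *)

(** One point is picked in each cell [k, k + 1) that meets X; boundedness leaves finitely many
    cells. The number of points picked bounds both [covnum] and [Nint] up to a factor, so both
    hypotheses on E reduce to [coarse_growth]. *)
Lemma floor_transversal (R : realType) (X : set R) (r : R) :
    (forall x, X x -> `|x| < r) ->
  exists (m : nat) (p : 'I_m -> R),
    [/\ forall i, X (p i), injective (fun i => Num.floor (p i)) &
      forall x, X x -> exists i, Num.floor (p i) = Num.floor x].
Proof.
move=> Xr; pose N := (Num.trunc r).+1.
have rN : r < N%:R by exact: truncnS_gt.
pose F (k : int) := exists2 x, X x & Num.floor x = k.
pose s := [seq k <- [seq i%:Z - N%:Z | i <- iota 0 (N + N)] | `[< F k >]].
have sF k : k \in s -> F k by rewrite mem_filter => /andP[/asboolP].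
have sX x : X x -> Num.floor x \in s.
  move=> Xx; rewrite mem_filter; apply/andP; split; first by apply/asboolP; exists x.
  have := Xr _ Xx; rewrite ltr_norml => /andP[x1 x2].
  have f1 : - N%:Z <= Num.floor x.
    rewrite floor_ge_int mulrNz; apply: ltW; apply: lt_trans x1.
    by rewrite ltrN2.
  have f2 : Num.floor x < N%:Z by rewrite floor_lt_int (lt_trans x2).
  apply/mapP; exists (absz (Num.floor x + N%:Z)); last first.
    by rewrite gez0_abs ?addrK //; lia.
  by rewrite mem_iota /=; lia.
have us : uniq s by rewrite filter_uniq // map_inj_uniq ?iota_uniq // => i j; lia.
have /boolp.choice [p pP] (i : 'I_(size s)) :
    exists x, X x /\ Num.floor x = s`_i.
  by have [x Xx e] := sF _ (mem_nth 0 (ltn_ord i)); exists x.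
exists (size s), p; split.
- by move=> i; have [] := pP i.
- move=> i j /=; rewrite (pP i).2 (pP j).2 => /eqP.
  by rewrite nth_uniq // => /eqP/val_inj.
- move=> x /sX fs; rewrite -index_mem in fs.
  by exists (Ordinal fs); rewrite (pP _).2 nth_index // -index_mem.
Qed.

Lemma covnum_le (X : set RR) m (p : 'I_m -> RR) :
    (forall x, X x -> exists i, Num.floor (p i) = Num.floor x) ->
  covnum X <= m%:R.
Proof.
move=> pX; apply: ge_inf; first by exists 0 => _ [k _ <-].
(* The open unit ball about the midpoint of a cell contains the cell. *)
exists m => //; exists (fun i => (Num.floor (p i))%:~R + 2^-1) => x Xx /=.
have [i e] := pX _ Xx; exists i; rewrite e ltr_norml.
have := floor_itv x; rewrite intrD; lra.
Qed.

Lemma Nint_le (X : set RR) m (p : 'I_m -> RR) :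
    (forall x, X x -> exists i, Num.floor (p i) = Num.floor x) ->
  Nint X <= 2 * m%:R.
Proof.
move=> pX; apply: ge_sup; first by exists 0, [::].
move=> _ [s [us sX] <-].
pose t := [seq Num.floor (p i) | i <- enum 'I_m].
(* A point of [k, k + 1] has floor k, or k + 1 if it is the right endpoint; hence the shifted copy
   of [t]. *)
suff : (size s <= size (t ++ [seq (k - 1)%R | k <- t]))%N.
  rewrite /t size_cat !size_map -enumT size_enum_ord -(ler_nat RR) natrD.
  by rewrite mulr2n mulrDl mul1r.
apply: uniq_leq_size => // k /sX[x [Xx /andP[kx xk]]].
have [i e] := pX _ Xx.
have ft : Num.floor x \in t by apply/mapP; exists i; rewrite ?mem_enum.
rewrite mem_cat; have : k <= Num.floor x by rewrite floor_ge_int.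
have : Num.floor x <= k + 1.
  by rewrite -(ler_int RR) intrD (le_trans (floor_le _)).
move=> h1 h2; have [->|/eqP ne] := eqVneq k (Num.floor x); first by rewrite ft.
apply/orP; right; apply/mapP; exists (Num.floor x) => //; lia.
Qed.

(* The factor 2 absorbs the two unit intervals [k, k + 1] and [k - 1, k] that
   can meet X at a point of floor k. *)
Definition coarse_growth (R : realType) (E : set R) (s : R) :=
  forall r0, exists2 r, r0 < r & exists (m : nat) (p : 'I_m -> R),
    [/\ forall i, E (p i) /\ `|p i| < r, injective (fun i => Num.floor (p i)) &
      r `^ s <= 2 * m%:R].

Lemma dimCM_coarse_growth (E : set RR) :
  (0 < dimCM E)%E -> exists2 s, 0 < s & coarse_growth E s.
Proof.
move=> E0; have [s s0 sE] : exists2 s : RR, 0 < s & (s%:E < dimCM E)%E.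
  case: (dimCM E) E0 => [d||] //; last by exists 1; rewrite ?ltry.
  by rewrite lte_fin => d0; exists (d / 2); rewrite ?lte_fin; lra.
exists s => // r0.
(* The cut-off at 1 makes [ln r] positive, so the quotient can be cleared. *)
have : (s%:E < ereal_sup [set (ln (covnum (B1 r `&` E)) / ln r)%:E
      | r in [set r | (Num.max 1 r0 < r)%R]])%E.
  by apply: lt_le_trans sE _; apply: ereal_inf_lbound; exists (Num.max 1 r0).
move=> /ereal_sup_gt[_ [r /= + <-]]; rewrite gt_max => /andP[r1 r0r].
rewrite lte_fin ltr_pdivlMr ?ln_gt0 // => sr.
exists r => //.
have [m [p [pX pinj pf]]] := @floor_transversal _ (B1 r `&` E) r (fun x h => h.1).
exists m, p; split=> //; first by move=> i; have [] := pX i.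
have cov := covnum_le pf.
(* [ln] is 0 at nonpositive arguments, which would contradict [sr]. *)
have c0 : 0 < covnum (B1 r `&` E).
  rewrite ltNge; apply/negP => /ln0 c0; move: sr; rewrite c0 ltNge.
  by rewrite mulr_ge0 // ?ltW // ln_gt0.
have : r `^ s < covnum (B1 r `&` E).
  rewrite /powR gt_eqF ?(lt_trans _ r1) // -[ltRHS]lnK //.
  by rewrite ltr_expR.
have : 0 <= m%:R :> RR by [].
lra.
Qed.

Lemma Nint_coarse_growth (E : set RR) (s r0 : RR) :
    (forall r, r0 <= r -> powR r s <= Nint (B1 r `&` E)) ->
  coarse_growth E s.
Proof.
move=> H r1; pose r := Num.max r0 r1 + 1.
exists r; first by rewrite /r ltr_pwDr // le_max lexx orbT.
have [m [p [pX pinj pf]]] := @floor_transversal _ (B1 r `&` E) r (fun x h => h.1).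
exists m, p; split=> //; first by move=> i; have [] := pX i.
apply: le_trans (Nint_le pf); apply: H.
by rewrite /r ler_wpDr // le_max lexx.
Qed.

(** * Pigeonhole and perturbation of a form *)

(** Distinct congruent floors differ by at least L + 1, and passing from floors back to x and y
    loses less than 1. *)
Lemma floor_eqmod_far (R : realType) (x y : R) (L : nat) :
    Num.floor x != Num.floor y ->
    (Num.floor x = Num.floor y %[mod L.+1%:Z])%Z ->
  L%:R <= `|x - y|.
Proof.
move=> ne /eqP; rewrite eqz_mod_dvd => dv.
have fxy : L.+1%:R <= `|(Num.floor x - Num.floor y)%:~R| :> R.
  rewrite -intr_norm -natr_absz ler_nat dvdn_leq //.
  by rewrite absz_gt0 subr_eq0.
move: fxy; have := floor_itv x; have := floor_itv y.
rewrite !intrD mulrNz -natr1 !ler_normr; lra.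
Qed.

(** A tuple is labelled by the unit cell of its value under the form and by the residues mod L + 1
    of the floors of its coordinates. For two tuples with one label, the cell bounds the difference
    of the values, and the residues force coordinates that differ to be far apart. *)
Lemma coarse_pigeonhole (R : realType) (E : set R) (s : R) (n : nat)
    (a : 'I_n -> R) (L : nat) :
    coarse_growth E s -> 2 <= s * n%:R ->
  exists x y : 'I_n -> R, [/\ forall i, E (x i), forall i, E (y i),
    `|\sum_i a i * (x i - y i)| <= 1 & exists i, L%:R <= `|x i - y i|].
Proof.
move=> Es sn; pose A := \sum_i `|a i|.
have A0 : 0 <= A by exact: sumr_ge0.
pose C : R := (2 * L.+1%:R) ^+ n.
have C0 : 0 < C by rewrite exprn_gt0 // mulr_gt0.
(* C collects the factors 2^n from [coarse_growth] and (L + 1)^n from the residues. As r > 1, this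
   threshold gives r^2 > (2 A r + 1) C. *)
have [r + [m [p [Ep pinj rm]]]] := Es (Num.max 1 ((2 * A + 1) * C)).
rewrite gt_max => /andP[r1 rAC].
pose v (f : {ffun 'I_n -> 'I_m}) := \sum_i a i * p (f i).
have vA f : `|v f| <= A * r.
  rewrite (le_trans (ler_norm_sum _ _ _)) // /A mulr_suml ler_sum // => i _.
  by rewrite normrM ler_wpM2l // ltW // (Ep _).2.
pose B := Num.trunc (2 * A * r).
(* The shift by A r moves the values into [0, 2 A r], where truncation is the floor and [inord]
   loses nothing. *)
pose vB f : 'I_B.+1 := inord (Num.trunc (v f + A * r)).
have vBE f : vB f = Num.trunc (v f + A * r) :> nat.
  rewrite inordK // ltnS; apply: le_truncn.
  by have := vA f; rewrite ler_norml; lra.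
pose c i : 'I_L.+1 := inord (absz (Num.floor (p i) %% L.+1%:Z)%Z).
have cE i : (c i)%:Z = (Num.floor (p i) %% L.+1%:Z)%Z.
  have c0 : 0 <= (Num.floor (p i) %% L.+1%:Z)%Z by exact: modz_ge0.
  have : (Num.floor (p i) %% L.+1%:Z)%Z < L.+1%:Z by exact: ltz_pmod.
  by move=> c1; rewrite inordK; lia.
pose g f := (vB f, [ffun i => c (f i)]).
have /injectivePn[f [h fh gfh]] : ~~ injectiveb g.
  apply/negP => /injectiveP/leq_card.
  rewrite card_prod !card_ffun !card_ord => mB.
  (* Injective labels would give m^n <= (B + 1) (L + 1)^n, while r^2 <= r^(s n) <= (2 m)^n. *)
  have : r * r <= B.+1%:R * C.
    apply: (@le_trans _ _ ((2 * m%:R) ^+ n)).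
      apply: (@le_trans _ _ ((r `^ s) ^+ n)).
        rewrite -powR_mulrn ?powR_ge0 // -powRrM -expr2 -powR_mulrn; last lra.
        by apply: ler_powR; first exact: ltW.
      by rewrite lerXn2r ?nnegrE ?powR_ge0 // mulr_ge0.
    rewrite /C !exprMn mulrCA ler_pM2l ?exprn_gt0 //.
    by rewrite -!natrX -natrM ler_nat.
  have : B%:R <= 2 * A * r by rewrite truncn_le !mulr_ge0 //; lra.
  rewrite -natr1; nra.
have [vfh cfh] : vB f = vB h /\ forall i, c (f i) = c (h i).
  by case: gfh => -> /ffunP H; split=> // i; have := H i; rewrite !ffunE.
exists (fun i => p (f i)), (fun i => p (h i)); split.
- by move=> i; exact: (Ep _).1.
- by move=> i; exact: (Ep _).1.
- under eq_bigr do rewrite mulrBr.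
  rewrite sumrB -/(v f) -/(v h).
  have := congr1 val vfh; rewrite /= !vBE.
  have nn k : 0 <= v k + A * r by have := vA k; rewrite ler_norml; lra.
  have := truncn_itv (nn f); have := truncn_itv (nn h).
  move=> + + e; rewrite e -natr1 ler_norml; lra.
- have [i fi] : exists i, f i != h i.
    apply/existsP; rewrite -negb_forall; apply: contra fh => /forallP fh.
    by apply/eqP/ffunP => i; apply/eqP.
  exists i; apply: floor_eqmod_far; first by apply: contra fi => /eqP/pinj ->.
  by rewrite -!cE cfh.
Qed.

Lemma perturb_solution (R : realType) (E : set R) (s : R) (n : nat)
    (a : 'I_n -> R) (q e : R) :
    coarse_growth E s -> 2 <= s * n%:R -> 0 < e ->
  exists b x y : 'I_n -> R,
    [/\ forall i, `|a i - b i| < e, forall i, E (x i), forall i, E (y i) &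
      \sum_i b i * (x i - y i) = q].
Proof.
(* With this L, |q - S| <= 1 + |q| < e L <= e |x_j - y_j|, so the correction d of the j-th
   coefficient is smaller than e. *)
move=> Es sn e0; pose L := (Num.trunc ((1 + `|q|) / e)).+1.
have [x [y [Ex Ey S1 [j Lj]]]] := coarse_pigeonhole a L Es sn.
set S := \sum_i _ in S1; pose d := (q - S) / (x j - y j).
have eL : 1 + `|q| < e * L%:R by rewrite mulrC -ltr_pdivrMr // truncnS_gt.
have xy0 : 0 < `|x j - y j| by apply: lt_le_trans Lj; rewrite ltr0n.
have de : `|d| < e.
  rewrite normf_div ltr_pdivrMr //; apply: le_lt_trans (ler_normB _ _) _.
  have := ler_wpM2l (ltW e0) Lj; lra.
exists (fun i => a i + (if i == j then d else 0)), x, y; split => //.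
  by move=> i; rewrite opprD addNKr normrN; case: ifP; rewrite ?normr0.
under eq_bigr do rewrite mulrDl; rewrite big_split /= -/S.
rewrite (bigD1 j) //= eqxx big1 => [|i /negPf ->]; last by rewrite mul0r.
by rewrite addr0 /d divfK -?normr_gt0 // addrC subrK.
Qed.

(* Lets matrices be inferred as a completeNormedModType: the library has the
   completeness and the norm on them, but not the join. *)
HB.instance Definition _ (R : realType) (m n : nat) := Complete.on 'M[R]_(m, n).

(** * Baire category in the space of forms *)

Lemma continuous_row_form (R : realType) (n : nat) (d : 'I_n -> R) :
  continuous (fun a : 'rV[R]_n => \sum_i a ord0 i * d i).
Proof.
apply: continuous_big; first exact: add_continuous.
move=> i _ a; apply: (@continuousM _ _ (fun b : 'rV[R]_n => b ord0 i) (fun=> d i)).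
  exact: coord_continuous.
exact: cst_continuous.
Qed.

Lemma difference_form_dense (R : realType) (E : set R) (s : R) (n : nat) :
    coarse_growth E s -> 2 <= s * n%:R ->
  exists a : 'I_n -> R, forall q e : R, 0 < e ->
    exists x y : 'I_n -> R, [/\ forall i, E (x i), forall i, E (y i) &
      `|\sum_i a i * (x i - y i) - q| < e].
Proof.
move=> Es sn.
pose D := [set z : ('I_n -> R) * ('I_n -> R) |
  (forall i, E (z.1 i)) /\ (forall i, E (z.2 i))].
pose f (z : ('I_n -> R) * ('I_n -> R)) (a : 'rV[R]_n) :=
  \sum_i a ord0 i * (z.1 i - z.2 i).
(* Balls with rational centres and radii 1/(N + 1) form a countable family, as Baire's theorem
   requires; a code that decodes to no pair gets the whole space. *)
pose G (w : rat * nat) :=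
  \bigcup_(z in D) (f z @^-1` ball (ratr w.1 : R) w.2.+1%:R^-1).
pose F k := if unpickle k is Some w then G w else setT.
have FG : forall k, open (F k) /\ dense (F k : set 'rV[R]_n).
  move=> k; rewrite /F; case: unpickle => [w|]; last first.
    by split; [exact: openT | move=> O O0 _; rewrite setIT].
  split.
    apply: bigcup_open => z _; apply: open_comp; last exact: (@ball_open R R).
    by move=> a _; exact: continuous_row_form.
  move=> O [a Oa] Oo.
  have /nbhs_ballP[e /= e0 aeO] := open_nbhs_nbhs (conj Oo Oa).
  have [b [x [y [ab Ex Ey bq]]]] :=
    perturb_solution (fun i => a ord0 i) (ratr w.1) Es sn e0.
  exists (\row_i b i); split.
    by apply: aeO; split=> // i j; rewrite ord1 mxE; exact: ab.
  exists (x, y) => //=; rewrite /f /=.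
  by under eq_bigr do rewrite mxE; rewrite bq; exact: ballxx.
have [a [_ Fa]] := Baire FG (ex_intro _ 0 I : setT !=set0) openT.
exists (fun i => a ord0 i) => q e e0.
(* Half of e is for the distance from q to a rational u, half for the radius of the ball about u. *)
pose N := Num.trunc (2 / e).
have N0 : 0 < N.+1%:R^-1 :> R by rewrite invr_gt0.
have Ne : 2 * N.+1%:R^-1 < e.
  by rewrite ltr_pdivrMr // mulrC -ltr_pdivrMr // truncnS_gt.
have [u] : exists u : rat, ratr u \in `]q, (q + N.+1%:R^-1)[.
  by have [|u] := @rat_in_itvoo R q (q + N.+1%:R^-1); [rewrite ltrDl|exists u].
rewrite in_itv /= => /andP[qu uq].
have := Fa (pickle (u, N)) I; rewrite /F pickleK => -[[x y] [/= Ex Ey]].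
rewrite /ball /= => axy; exists x, y; split=> //.
move: axy; rewrite /f /= !ltr_norml; set S := \sum_i _.
by move: (N.+1%:R^-1) Ne qu uq => h; lra.
Qed.

Lemma coarse_growth_dense_image (E : set RR) (s : RR) :
    0 < s -> coarse_growth E s ->
  exists (n : nat) (T : {linear 'rV[RR]_n -> RR^o}),
    dense (T @` cartpow E n).
Proof.
move=> s0 Es; pose n := (Num.trunc (2 / s)).+1.
have sn : 2 <= s * n%:R by rewrite mulrC -ler_pdivrMr // ltW // truncnS_gt.
have [a aE] := difference_form_dense Es sn.
(* The coefficients are (a, -a), so the values of T on E^(2n) are those of a on E^n - E^n. *)
pose T (z : 'rV[RR]_(n + n)) : RR^o :=
  \sum_i a i * (z ord0 (lshift n i) - z ord0 (rshift n i)).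
have Tlin : linear T.
  move=> k u v; rewrite /T scaler_sumr -big_split /=; apply: eq_bigr => i _.
  by rewrite !mxE /GRing.scale /=; ring.
exists (n + n)%N, (HB.pack_for {linear 'rV[RR]_(n + n) -> RR^o} T
  (GRing.isLinear.Build _ _ _ _ T Tlin)).
move=> O [q Oq] Oo.
have /nbhs_ballP[e /= e0 qeO] := open_nbhs_nbhs (conj Oo Oq).
have [x [y [Ex Ey xyq]]] := aE q e e0.
exists (\sum_i a i * (x i - y i)); split.
  by apply: qeO; rewrite /ball /= distrC.
exists (row_mx (\row_i x i) (\row_i y i)).
  move=> i; rewrite -[i]splitK.
  by case: (fintype.split i) => j /=; rewrite ?row_mxEl ?row_mxEr mxE.
by apply: eq_bigr => i _; rewrite row_mxEl row_mxEr !mxE.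
Qed.

Theorem theorem1p1 (E : set Rdefinitions.R) :
  ((0 < dimCM E)%E ->
     exists (n : nat) (T : {linear 'rV[Rdefinitions.R]_n -> Rdefinitions.R^o}),
       dense (T @` cartpow E n)) /\
  ((exists s : Rdefinitions.R, 0 < s /\
      exists r0 : Rdefinitions.R, forall r : Rdefinitions.R, r0 <= r ->
        powR r s <= Nint (B1 r `&` E)) ->
     exists (n : nat) (T : {linear 'rV[Rdefinitions.R]_n -> Rdefinitions.R^o}),
       dense (T @` cartpow E n)).
Proof.
split.
  by move=> /dimCM_coarse_growth[s s0]; exact: coarse_growth_dense_image.
move=> [s [s0 [r0 H]]]; apply: (coarse_growth_dense_image s0).
exact: Nint_coarse_growth H.
Qed.
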